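(* Under the identification $q=v^2$, $z_1=q^{\lambda_1-\lambda_2+1}$, $z_2=q^{\lambda_2-\lambda_3+1}$, for all integers $d_1,d_2\ge0$ and $0\le n\le\min(d_1,d_2)$, $$I_{d_1,d_2,n}(z_1,z_2)=(\omega_{d_1,d_2,n},\bar \omega_{d_1,d_2,n}),$$ where $\omega_{d_1,d_2,n}$, $\bar\omega_{d_1,d_2,n}$ are the Gelfand–Tsetlin components $$\omega_{d_1,d_2,n}=\frac{v^{r(d_1,d_2,n)}}{(1-v^2)^{d_1+d_2}}\sqrt{c(d_1,d_2,n)}\; m_{d_1,d_2,n},\qquad \bar\omega_{d_1,d_2,n}=\frac{v^{-r(d_1,d_2,n)+s(d_1,d_2)}}{(1-v^{-2})^{d_1+d_2}}\sqrt{c(d_1,d_2,n)}\;\bar m_{d_1,d_2,n}$$ of the Whittaker and dual Whittaker vectors, $(\ ,\ )$ is the pairing $\mathcal V_v\otimes\mathcal V_{v^{-1}}\to\mathcal R$, and $$I_{d_1,d_2,n}(z_1,z_2)=\frac{1}{(q)_{d_1-n}(q)_{d_2-n}(q)_n}\cdot\frac{(qz_2)_\infty}{(qz_1^{-1})_{d_1-n}(qz_1^{-1}z_2^{-1})_n (q^{d_1-2n+1}z_2)_\infty(q^{-d_1+2n+1}z_2^{-1})_{d_2-n} (qz_2)_{d_1-n}(qz_2^{-1})_n}.$$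
   Context: $(a)_n=\prod_{i=0}^{n-1}(1-aq^i)$, $(a)_\infty=\prod_{i\ge0}(1-aq^i)$; $(qz_2)_\infty/(q^{d_1-2n+1}z_2)_\infty$ is a rational function. **Quantum groups.** $U_v(\mathfrak{sl}_3)$ is the $\mathbb C(v)$-algebra with generators $K_i^{\pm1},E_i,F_i$ ($i=1,2$) and relations, for $i\ne j$: $K_iK_i^{-1}=1$, $K_iK_j=K_jK_i$, $K_iE_i=v^2E_iK_i$, $K_iF_i=v^{-2}F_iK_i$, $K_iE_j=v^{-1}E_jK_i$, $K_iF_j=vF_jK_i$, $E_iF_i-F_iE_i=\frac{K_i-K_i^{-1}}{v-v^{-1}}$, $E_iF_j=F_jE_i$, $E_i^2E_j-(v+v^{-1})E_iE_jE_i+E_jE_i^2=0$, $F_i^2F_j-(v+v^{-1})F_iF_jF_i+F_jF_i^2=0$. $U_{v^{-1}}(\mathfrak{sl}_3)$ is the same with $v$ replaced by $v^{-1}$; its generators are written $\bar K_i^{\pm1},\bar E_i,\bar F_i$. Let $\sigma:U_v(\mathfrak{sl}_3)\to U_{v^{-1}}(\mathfrak{sl}_3)$ be the $\mathbb C(v)$-algebra isomorphism $E_i\mapsto\bar E_i$, $F_i\mapsto\bar F_i$, $K_i\mapsto\bar K_i^{-1}$, and $\tau$ the anti-automorphism $E_i\mapsto F_i$, $F_i\mapsto E_i$, $K_i\mapsto K_i$ of $U_v(\mathfrak{sl}_3)$. **Coefficients.** $\lambda_1,\lambda_2$ are formal variables, $\lambda_3=-\lambda_1-\lambda_2$. Let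 $\mathcal R$ be the ring spanned by all square roots $\sqrt g$, $g\in\mathbb C(v,v^{\lambda_1},v^{\lambda_2})$ (inside a fixed algebraic closure); scalars are extended to $\mathcal R$. Put $[a]=\frac{v^a-v^{-a}}{v-v^{-1}}$, $[a]!=\prod_{i=1}^a[i]$, $[a]_b=\prod_{i=0}^{b-1}[a+i]$. A square root $\sqrt{[x]}$ is fixed once for each $x$ that is a positive integer or of the form $\lambda_i-\lambda_j+\text{integer}$ with $i<j$, and square roots of products and quotients of such $[x]$ are defined multiplicatively ($\sqrt0=0$). **Verma modules.** $\mathcal V_v$ is the $U_v(\mathfrak{sl}_3)$-module generated by $w$ with defining relations $K_1w=v^{\lambda_1-\lambda_2}w$, $K_2w=v^{\lambda_2-\lambda_3}w$, $E_1w=E_2w=0$. $\mathcal V_{v^{-1}}$ is the $U_{v^{-1}}(\mathfrak{sl}_3)$-module generated by $\bar w$ with defining relations $\bar K_1\bar w=v^{\lambda_2-\lambda_1}\bar w$, $\bar K_2\bar w=v^{\lambda_3-\lambda_2}\bar w$, $\bar E_1\bar w=\bar E_2\bar w=0$. There is a unique non-degenerate $\mathcal R$-bilinear pairing $(\ ,\ ):\mathcal V_v\otimes\mathcal V_{v^{-1}}\to\mathcal R$ with $(w,\bar w)=1$ and $(gw_1,\bar w_2)=(w_1,(\sigma\circ\tau)(g)\bar w_2)$ for all $g\in U_v(\mathfrak{sl}_3)$, $w_1\in\mathcal V_v$, $\bar w_2\in\mathcal V_{v^{-1}}$. **Gelfand–Tsetlin bases.** $\mathcal V_v$ has the basis $\{m_{d_1,d_2,n}: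 d_1,d_2,n\in\mathbb Z_{\ge0},\ n\le\min(d_1,d_2)\}$ with $m_{0,0,0}=w$, $K_1m_{d_1,d_2,n}=v^{\lambda_1-\lambda_2-2d_1+d_2}m_{d_1,d_2,n}$, $K_2m_{d_1,d_2,n}=v^{\lambda_2-\lambda_3-2d_2+d_1}m_{d_1,d_2,n}$, and $$\begin{aligned}E_1m_{d_1,d_2,n}&=\sqrt{b_1(d_1,d_2,n)}\,m_{d_1-1,d_2,n-1}+\sqrt{b_2(d_1,d_2,n)}\,m_{d_1-1,d_2,n},\\ F_1m_{d_1,d_2,n}&=\sqrt{b_1(d_1+1,d_2,n+1)}\,m_{d_1+1,d_2,n+1}+\sqrt{b_2(d_1+1,d_2,n)}\,m_{d_1+1,d_2,n},\\ E_2m_{d_1,d_2,n}&=\sqrt{a(d_1,d_2,n)}\,m_{d_1,d_2-1,n},\qquad F_2m_{d_1,d_2,n}=\sqrt{a(d_1,d_2+1,n)}\,m_{d_1,d_2+1,n},\end{aligned}$$ where $$\begin{aligned}a(d_1,d_2,n)&=[d_2-n][\lambda_2-\lambda_3+d_1-d_2-n+1],\\ b_1(d_1,d_2,n)&=\frac{[d_2-n+1][n][\lambda_2-\lambda_3-n+1][\lambda_1-\lambda_3-n+2]}{[\lambda_2-\lambda_3+d_1-2n+1][\lambda_2-\lambda_3+d_1-2n+2]},\\ b_2(d_1,d_2,n)&=\frac{[d_1-n][\lambda_2-\lambda_3+d_1-d_2-n][\lambda_2-\lambda_3+d_1-n+1][\lambda_1-\lambda_2-d_1+n+1]}{[\lambda_2-\lambda_3+d_1-2n][\lambda_2-\lambda_3+d_1-2n+1]}.\end{aligned}$$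 $\mathcal V_{v^{-1}}$ has the analogous basis $\bar m_{d_1,d_2,n}$, $\bar m_{0,0,0}=\bar w$, on which $\bar E_i,\bar F_i$ act by the same formulas and $\bar K_i$ acts by the inverse of the eigenvalue of $K_i$ on $m_{d_1,d_2,n}$. **Coefficients of the components.** $$r(d_1,d_2,n)=(\lambda_2-\lambda_3+d_1+1)n-n^2+(\lambda_1-\lambda_2-1)d_1-d_1^2,$$ $$s(d_1,d_2)=-d_1^2-d_2^2+d_1d_2+(\lambda_1-\lambda_2)d_1+(\lambda_2-\lambda_3)d_2,$$ $$c(d_1,d_2,n)=\frac{1}{[d_1-n]!\,[d_2-n]!\,[n]!}\cdot\frac{1}{[\lambda_1-\lambda_2-d_1+n+1]_{d_1-n}[\lambda_1-\lambda_3-n+2]_n[\lambda_2-\lambda_3+2]_{d_1-n}}\cdot\frac{[\lambda_2-\lambda_3+2]_\infty/[\lambda_2-\lambda_3+d_1-2n+2]_\infty}{[\lambda_2-\lambda_3+d_1-d_2-n+1]_{d_2-n}[\lambda_2-\lambda_3-n+1]_n},$$ where $[\lambda_2-\lambda_3+2]_\infty/[\lambda_2-\lambda_3+d_1-2n+2]_\infty$ means $[\lambda_2-\lambda_3+2]_{d_1-2n}$ if $d_1\ge2n$ and $1/[\lambda_2-\lambda_3+d_1-2n+2]_{2n-d_1}$ if $d_1<2n$. *)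

(* Defs.v *)
From HB Require Import structures.
From mathcomp Require Import all_boot all_order all_algebra.
From mathcomp Require Import generic_quotient ring_quotient.
From mathcomp Require Import boolp reals complex mpoly.

Set Implicit Arguments.
Unset Strict Implicit.
Unset Printing Implicit Defensive.

Import GRing.Theory.

Local Open Scope ring_scope.
Local Open Scope quotient_scope.

Section SqrtRing.
Variables (K : fieldType) (Omega : closedFieldType) (iota : {rmorphism K -> Omega}).

Definition is_sqrt_from (y : Omega) : Prop := exists g : K, y ^+ 2 = iota g.

(* A scalar multiple c * sqrt g, with c in K, is a square root of c ^+ 2 * g;
   hence the span of the square roots, over K or over any subring of K, is the
   set of finite sums of square roots. *)
Definition sqrt_span : {pred Omega} := fun x =>
  `[< exists s : seq Omega,
        (forall y, y \in s -> is_sqrt_from y) /\ x = \sum_(y <- s) y >].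

Lemma sqrt_spanP x : x \in sqrt_span <->
  exists s : seq Omega, (forall y, y \in s -> is_sqrt_from y) /\ x = \sum_(y <- s) y.
Proof. by split=> [/asboolP|?]; last exact/asboolP. Qed.

Lemma sqrt_span_sqrt y : is_sqrt_from y -> y \in sqrt_span.
Proof.
move=> hy; apply/sqrt_spanP; exists [:: y]; rewrite big_seq1; split=> // z.
by rewrite inE => /eqP->.
Qed.

Lemma sqrt_span_iota g : iota g \in sqrt_span.
Proof. by apply: sqrt_span_sqrt; exists (g ^+ 2); rewrite rmorphXn. Qed.

Lemma sqrt_span0 : 0 \in sqrt_span.
Proof. by rewrite -(rmorph0 iota) sqrt_span_iota. Qed.

Lemma sqrt_spanD : {in sqrt_span &, forall x y, x + y \in sqrt_span}.
Proof.
move=> x y /sqrt_spanP[s [hs ->]] /sqrt_spanP[t [ht ->]].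
apply/sqrt_spanP; exists (s ++ t); rewrite big_cat; split=> // z.
by rewrite mem_cat => /orP[/hs|/ht].
Qed.

Lemma sqrt_span_sum (I : eqType) (r : seq I) (F : I -> Omega) :
  (forall i, i \in r -> F i \in sqrt_span) -> \sum_(i <- r) F i \in sqrt_span.
Proof.
move=> h; rewrite big_seq; elim/big_ind: _ => //; first exact: sqrt_span0.
exact: sqrt_spanD.
Qed.

Lemma sqrt_spanM : {in sqrt_span &, forall x y, x * y \in sqrt_span}.
Proof.
move=> x y /sqrt_spanP[s [hs ->]] /sqrt_spanP[t [ht ->]].
rewrite mulr_suml; apply: sqrt_span_sum => a /hs[g hg].
rewrite mulr_sumr; apply: sqrt_span_sum => b /ht[h hh].
by apply: sqrt_span_sqrt; exists (g * h); rewrite exprMn hg hh rmorphM.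
Qed.

Lemma sqrt_spanN : {in sqrt_span, forall x, - x \in sqrt_span}.
Proof.
move=> x hx; rewrite -mulN1r -(rmorphN1 iota).
by apply: sqrt_spanM => //; exact: sqrt_span_iota.
Qed.

Lemma sqrt_span_algebraic x : x \in sqrt_span -> algebraicOver iota x.
Proof.
case/sqrt_spanP=> s [hs ->]; rewrite big_seq.
elim/big_ind: _ => [|a b|y /hs [g hg]]; first exact: algebraic0.
  exact: algebraic_add.
exists ('X^2 - g%:P); first by rewrite -size_poly_eq0 size_XnsubC.
by rewrite /root rmorphB /= map_polyXn map_polyC /= !hornerE hg subrr.
Qed.

Lemma sqrt_spanX n : {in sqrt_span, forall x, x ^+ n \in sqrt_span}.
Proof.
move=> x hx; elim: n => [|n IH]; first by rewrite expr0 -(rmorph1 iota) sqrt_span_iota.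
by rewrite exprS sqrt_spanM.
Qed.

Lemma sqrt_spanV : {in sqrt_span, forall x, x^-1 \in sqrt_span}.
Proof.
move=> x hx; have [->|x0] := eqVneq x 0; first by rewrite invr0 sqrt_span0.
have /integral_algebraic [q mq rq] := algebraic_inv (sqrt_span_algebraic hx).
have sq0 : (0 < size q)%N by rewrite size_poly_gt0 monic_neq0.
move: rq; rewrite /root horner_coef size_map_poly.
case Eq: (size q) sq0 => [//|n] _.
rewrite big_ord_recr /= coef_map /=.
have -> : q`_n = 1 by move/monicP: mq; rewrite /lead_coef Eq.
rewrite rmorph1 mul1r addrC addr_eq0 => /eqP h.
case: n Eq h => [|n] Eq h.
  by move: h; rewrite big_ord0 oppr0 expr0 => /eqP; rewrite oner_eq0.
have -> : x^-1 = x^-1 ^+ n.+1 * x ^+ n.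
  by rewrite exprS -mulrA -exprMn mulVf // expr1n mulr1.
rewrite h mulNr mulr_suml sqrt_spanN //; apply: sqrt_span_sum => i _.
rewrite coef_map /= -mulrA sqrt_spanM ?sqrt_span_iota //.
have -> : x ^+ n = x ^+ i * x ^+ (n - i) by rewrite -exprD subnKC // -ltnS.
by rewrite mulrA -exprMn mulVf // expr1n mul1r sqrt_spanX.
Qed.

Lemma sqrt_span_divring : divring_closed sqrt_span.
Proof.
split=> [|x y hx hy|x y hx hy].
- by rewrite -(rmorph1 iota) sqrt_span_iota.
- by rewrite sqrt_spanD ?sqrt_spanN.
- by rewrite sqrt_spanM ?sqrt_spanV.
Qed.
HB.instance Definition _ :=
  GRing.isDivringClosed.Build Omega sqrt_span sqrt_span_divring.

(* Every element of this ring is algebraic over K, so the ring is a field. *)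
Record sqrt_ring := SqrtRing { sqrt_ring_val : Omega; _ : sqrt_ring_val \in sqrt_span }.

HB.instance Definition _ := [isSub for sqrt_ring_val].
HB.instance Definition _ := [Choice of sqrt_ring by <:].
HB.instance Definition _ := [SubChoice_isSubIntegralDomain of sqrt_ring by <:].
HB.instance Definition _ := [SubIntegralDomain_isSubField of sqrt_ring by <:].

Definition sqrt_ring_in (g : K) : sqrt_ring := SqrtRing (sqrt_span_iota g).

End SqrtRing.
Arguments sqrt_ring {K Omega} iota.
Arguments sqrt_ring_in {K Omega} iota g.

Inductive node := node1 | node2.

(* Ki i is the inverse of K i. *)
Record sl3_rels (k : fieldType) (u : k) (A : algType k) (K Ki E F : node -> A)
    : Prop := Sl3Rels {
  rel_KKi : forall i, K i * Ki i = 1;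
  rel_KiK : forall i, Ki i * K i = 1;
  rel_KK : forall i j, i <> j -> K i * K j = K j * K i;
  rel_KE : forall i, K i * E i = u ^+ 2 *: (E i * K i);
  rel_KF : forall i, K i * F i = u ^- 2 *: (F i * K i);
  rel_KE' : forall i j, i <> j -> K i * E j = u^-1 *: (E j * K i);
  rel_KF' : forall i j, i <> j -> K i * F j = u *: (F j * K i);
  rel_EF : forall i, E i * F i - F i * E i = (u - u^-1)^-1 *: (K i - Ki i);
  rel_EF' : forall i j, i <> j -> E i * F j = F j * E i;
  rel_EEE : forall i j, i <> j ->
    E i ^+ 2 * E j - (u + u^-1) *: (E i * E j * E i) + E j * E i ^+ 2 = 0;
  rel_FFF : forall i j, i <> j ->
    F i ^+ 2 * F j - (u + u^-1) *: (F i * F j * F i) + F j * F i ^+ 2 = 0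
}.

Section QuantumGroup.
Variables (k : fieldType) (u : k).

Inductive gen := GenK of node | GenKi of node | GenE of node | GenF of node.

Inductive term :=
  | Cst of k
  | Gen of gen
  | Add of term & term
  | Mul of term & term.

Definition gen_val (A : algType k) (K Ki E F : node -> A) (x : gen) : A :=
  match x with
  | GenK i => K i | GenKi i => Ki i | GenE i => E i | GenF i => F i
  end.

Fixpoint eval (A : algType k) (f : gen -> A) (t : term) : A :=
  match t with
  | Cst c => c%:A
  | Gen x => f x
  | Add t1 t2 => eval f t1 + eval f t2
  | Mul t1 t2 => eval f t1 * eval f t2
  end.

(* Two expressions are identified when the defining relations force them to be
   equal, i.e. when they are equal in every algebra where the relations hold.
   The quotient is the algebra presented by these generators and relations;
   see Uq_lift and Uq_lift_unique. *)
Definition term_eq (s t : term) : Prop :=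
  forall (A : algType k) (K Ki E F : node -> A), sl3_rels u K Ki E F ->
  eval (gen_val K Ki E F) s = eval (gen_val K Ki E F) t.

Definition term_eqb : rel term := fun s t => `[< term_eq s t >].

Lemma term_eqb_equiv : equiv_class_of term_eqb.
Proof.
split=> [s|s t|t s r]; first by apply/asboolP.
- by apply/asboolP/asboolP => h A K Ki E F r; rewrite h.
- by move=> /asboolP h1 /asboolP h2; apply/asboolP => A K Ki E F r0; rewrite h1 ?h2.
Qed.

HB.instance Definition _ := gen_eqMixin term.
HB.instance Definition _ := gen_choiceMixin term.

Canonical term_equiv := EquivRelPack term_eqb_equiv.

Definition Uq := {eq_quot term_equiv}.
HB.instance Definition _ := Choice.on Uq.
HB.instance Definition _ := EqQuotient.on Uq.

Definition toU (t : term) : Uq := \pi t.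

Lemma toUP s t : toU s = toU t <-> term_eq s t.
Proof.
split; first by move/eqmodP/asboolP.
by move=> h; apply/eqmodP/asboolP.
Qed.

Lemma toU_repr (x : Uq) : toU (repr x) = x.
Proof. exact: reprK. Qed.

Lemma toU_ind (P : Uq -> Prop) : (forall t, P (toU t)) -> forall x, P x.
Proof. by move=> h x; rewrite -(toU_repr x). Qed.

Definition Uadd (x y : Uq) := toU (Add (repr x) (repr y)).
Definition Umul (x y : Uq) := toU (Mul (repr x) (repr y)).
Definition Uscale (c : k) (x : Uq) := toU (Mul (Cst c) (repr x)).
Definition Uopp (x : Uq) := Uscale (-1) x.

Lemma toUD s t : Uadd (toU s) (toU t) = toU (Add s t).
Proof.
apply/toUP => A K Ki E F r /=.
by congr (_ + _); move: A K Ki E F r; apply/toUP; rewrite toU_repr.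
Qed.

Lemma toUM s t : Umul (toU s) (toU t) = toU (Mul s t).
Proof.
apply/toUP => A K Ki E F r /=.
by congr (_ * _); move: A K Ki E F r; apply/toUP; rewrite toU_repr.
Qed.

Lemma toUZ c t : Uscale c (toU t) = toU (Mul (Cst c) t).
Proof.
apply/toUP => A K Ki E F r /=.
by congr (_ * _); move: A K Ki E F r; apply/toUP; rewrite toU_repr.
Qed.

Let toUE := (toUD, toUM, toUZ).

Lemma UaddA : associative Uadd.
Proof.
elim/toU_ind=> r; elim/toU_ind=> s; elim/toU_ind=> t; rewrite !toUE.
by apply/toUP => A K Ki E F _ /=; rewrite addrA.
Qed.

Lemma UaddC : commutative Uadd.
Proof.
elim/toU_ind=> s; elim/toU_ind=> t; rewrite !toUE.
by apply/toUP => A K Ki E F _ /=; rewrite addrC.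
Qed.

Lemma Uadd0 : left_id (toU (Cst 0)) Uadd.
Proof.
by elim/toU_ind=> s; rewrite toUE; apply/toUP => A K Ki E F _ /=; rewrite scale0r add0r.
Qed.

Lemma UaddN : left_inverse (toU (Cst 0)) Uopp Uadd.
Proof.
elim/toU_ind=> s; rewrite /Uopp !toUE.
by apply/toUP => A K Ki E F _ /=; rewrite scaleN1r mulN1r addNr scale0r.
Qed.

HB.instance Definition _ := GRing.isZmodule.Build Uq UaddA UaddC Uadd0 UaddN.

Lemma UmulA : associative Umul.
Proof.
elim/toU_ind=> r; elim/toU_ind=> s; elim/toU_ind=> t; rewrite !toUE.
by apply/toUP => A K Ki E F _ /=; rewrite mulrA.
Qed.

Lemma Umul1 : left_id (toU (Cst 1)) Umul.
Proof.
by elim/toU_ind=> s; rewrite toUE; apply/toUP => A K Ki E F _ /=; rewrite scale1r mul1r.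
Qed.

Lemma UmulR1 : right_id (toU (Cst 1)) Umul.
Proof.
by elim/toU_ind=> s; rewrite toUE; apply/toUP => A K Ki E F _ /=; rewrite scale1r mulr1.
Qed.

Lemma UmulDl : left_distributive Umul +%R.
Proof.
elim/toU_ind=> r; elim/toU_ind=> s; elim/toU_ind=> t; rewrite /+%R /= !toUE.
by apply/toUP => A K Ki E F _ /=; rewrite mulrDl.
Qed.

Lemma UmulDr : right_distributive Umul +%R.
Proof.
elim/toU_ind=> r; elim/toU_ind=> s; elim/toU_ind=> t; rewrite /+%R /= !toUE.
by apply/toUP => A K Ki E F _ /=; rewrite mulrDr.
Qed.

Lemma sl3_rels_triv : @sl3_rels k u k^o (fun=> 1) (fun=> 1) (fun=> 0) (fun=> 0).
Proof.
by split=> *; rewrite ?(mul0r, mulr0, mulr1, scaler0, subrr, addr0, expr0n) ?scaler0.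
Qed.

Lemma Uone_neq0 : toU (Cst 1) != 0.
Proof.
apply/eqP => /toUP /(_ _ _ _ _ _ sl3_rels_triv) /= /eqP.
by rewrite scale1r scale0r oner_eq0.
Qed.

HB.instance Definition _ :=
  GRing.Zmodule_isNzRing.Build Uq UmulA Umul1 UmulR1 UmulDl UmulDr Uone_neq0.

Lemma UscaleA a b x : Uscale a (Uscale b x) = Uscale (a * b) x.
Proof.
elim/toU_ind: x => s; rewrite !toUE; apply/toUP => A K Ki E F _ /=.
by rewrite mulrA -scalerAl mul1r scalerA.
Qed.

Lemma Uscale1 : left_id 1 Uscale.
Proof.
by elim/toU_ind=> s; rewrite toUE; apply/toUP => A K Ki E F _ /=; rewrite scale1r mul1r.
Qed.

Lemma UscaleDr : right_distributive Uscale +%R.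
Proof.
move=> a; elim/toU_ind=> s; elim/toU_ind=> t; rewrite /+%R /= !toUE.
by apply/toUP => A K Ki E F _ /=; rewrite mulrDr.
Qed.

Lemma UscaleDl x : {morph Uscale^~ x : a b / a + b}.
Proof.
move=> a b; elim/toU_ind: x => s; rewrite {2}/+%R /= !toUE.
by apply/toUP => A K Ki E F _ /=; rewrite scalerDl mulrDl.
Qed.

HB.instance Definition _ :=
  GRing.Zmodule_isLmodule.Build k Uq UscaleA Uscale1 UscaleDr UscaleDl.

Lemma UscaleAl (a : k) (x y : Uq) : a *: (x * y) = a *: x * y.
Proof.
elim/toU_ind: x => s; elim/toU_ind: y => t; rewrite /GRing.scale /GRing.mul /= !toUE.
by apply/toUP => A K Ki E F _ /=; rewrite mulrA.
Qed.

HB.instance Definition _ := GRing.Lmodule_isLalgebra.Build k Uq UscaleAl.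

Lemma UscaleAr (a : k) (x y : Uq) : a *: (x * y) = x * (a *: y).
Proof.
elim/toU_ind: x => s; elim/toU_ind: y => t; rewrite /GRing.scale /GRing.mul /= !toUE.
by apply/toUP => A K Ki E F _ /=; rewrite -!scalerAl !mul1r scalerAr.
Qed.

HB.instance Definition _ := GRing.Lalgebra_isAlgebra.Build k Uq UscaleAr.

Definition UK i : Uq := toU (Gen (GenK i)).
Definition UKi i : Uq := toU (Gen (GenKi i)).
Definition UE i : Uq := toU (Gen (GenE i)).
Definition UF i : Uq := toU (Gen (GenF i)).

Lemma eval_toU t : eval (gen_val UK UKi UE UF) t = toU t.
Proof.
elim: t => [c|[]//|s IHs t IHt|s IHs t IHt] /=.
- rewrite /GRing.scale /GRing.one /= toUZ; apply/toUP => A K Ki E F _ /=.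
  by rewrite scale1r mulr1.
- by rewrite IHs IHt /GRing.add /= toUD.
- by rewrite IHs IHt /GRing.mul /= toUM.
Qed.

Lemma toU_rel s t : term_eq s t ->
  eval (gen_val UK UKi UE UF) s = eval (gen_val UK UKi UE UF) t.
Proof. by rewrite !eval_toU => /toUP. Qed.

Lemma Uq_rels : sl3_rels u UK UKi UE UF.
Proof.
pose K i := Gen (GenK i); pose Ki i := Gen (GenKi i).
pose E i := Gen (GenE i); pose F i := Gen (GenF i).
pose N t := Mul (Cst (-1)) t; pose Z c t := Mul (Cst c) t.
have ZE (A : algType k) c (x : A) : c%:A * x = c *: x by rewrite -scalerAl mul1r.
have NE (A : algType k) (x : A) : (-1)%:A * x = - x by rewrite ZE scaleN1r.
split=> [i|i|i j ij|i|i|i j ij|i j ij|i|i j ij|i j ij|i j ij].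
- have := @toU_rel (Mul (K i) (Ki i)) (Cst 1); rewrite /= scale1r; apply.
  by move=> A K0 Ki0 E0 F0 r /=; rewrite scale1r (rel_KKi r).
- have := @toU_rel (Mul (Ki i) (K i)) (Cst 1); rewrite /= scale1r; apply.
  by move=> A K0 Ki0 E0 F0 r /=; rewrite scale1r (rel_KiK r).
- have := @toU_rel (Mul (K i) (K j)) (Mul (K j) (K i)); apply.
  by move=> A K0 Ki0 E0 F0 r /=; rewrite (rel_KK r ij).
- have := @toU_rel (Mul (K i) (E i)) (Z (u ^+ 2) (Mul (E i) (K i))).
  rewrite /= ZE; apply=> A K0 Ki0 E0 F0 r /=; by rewrite ZE (rel_KE r).
- have := @toU_rel (Mul (K i) (F i)) (Z (u ^- 2) (Mul (F i) (K i))).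
  rewrite /= ZE; apply=> A K0 Ki0 E0 F0 r /=; by rewrite ZE (rel_KF r).
- have := @toU_rel (Mul (K i) (E j)) (Z (u^-1) (Mul (E j) (K i))).
  rewrite /= ZE; apply=> A K0 Ki0 E0 F0 r /=; by rewrite ZE (rel_KE' r ij).
- have := @toU_rel (Mul (K i) (F j)) (Z u (Mul (F j) (K i))).
  rewrite /= ZE; apply=> A K0 Ki0 E0 F0 r /=; by rewrite ZE (rel_KF' r ij).
- have := @toU_rel (Add (Mul (E i) (F i)) (N (Mul (F i) (E i))))
                   (Z (u - u^-1)^-1 (Add (K i) (N (Ki i)))).
  rewrite /= !NE ZE; apply=> A K0 Ki0 E0 F0 r /=; by rewrite !NE ZE (rel_EF r).
- have := @toU_rel (Mul (E i) (F j)) (Mul (F j) (E i)); apply.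
  by move=> A K0 Ki0 E0 F0 r /=; rewrite (rel_EF' r ij).
- have := @toU_rel (Add (Add (Mul (Mul (E i) (E i)) (E j))
    (N (Z (u + u^-1) (Mul (Mul (E i) (E j)) (E i))))) (Mul (E j) (Mul (E i) (E i))))
    (Cst 0).
  rewrite /= NE ZE scale0r -!expr2; apply=> A K0 Ki0 E0 F0 r /=.
  by rewrite NE ZE scale0r -!expr2 (rel_EEE r ij).
- have := @toU_rel (Add (Add (Mul (Mul (F i) (F i)) (F j))
    (N (Z (u + u^-1) (Mul (Mul (F i) (F j)) (F i))))) (Mul (F j) (Mul (F i) (F i))))
    (Cst 0).
  rewrite /= NE ZE scale0r -!expr2; apply=> A K0 Ki0 E0 F0 r /=.
  by rewrite NE ZE scale0r -!expr2 (rel_FFF r ij).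
Qed.

Section Lift.
Variables (A : algType k) (K Ki E F : node -> A).

Definition Uq_lift (x : Uq) : A := eval (gen_val K Ki E F) (repr x).

Hypothesis r : sl3_rels u K Ki E F.

Lemma Uq_liftE t : Uq_lift (toU t) = eval (gen_val K Ki E F) t.
Proof.
have /toUP h : toU (repr (toU t)) = toU t by exact: toU_repr.
exact: h r.
Qed.

Lemma Uq_liftK i : Uq_lift (UK i) = K i. Proof. exact: Uq_liftE. Qed.
Lemma Uq_liftKi i : Uq_lift (UKi i) = Ki i. Proof. exact: Uq_liftE. Qed.
Lemma Uq_lift_E i : Uq_lift (UE i) = E i. Proof. exact: Uq_liftE. Qed.
Lemma Uq_lift_F i : Uq_lift (UF i) = F i. Proof. exact: Uq_liftE. Qed.

Lemma Uq_lift1 : Uq_lift 1 = 1.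
Proof. by rewrite Uq_liftE /= scale1r. Qed.

Lemma Uq_liftD : {morph Uq_lift : x y / x + y}.
Proof.
elim/toU_ind=> s; elim/toU_ind=> t.
by rewrite {1}/+%R /= toUD !Uq_liftE.
Qed.

Lemma Uq_liftM : {morph Uq_lift : x y / x * y}.
Proof.
elim/toU_ind=> s; elim/toU_ind=> t.
by rewrite {1}/GRing.mul /= toUM !Uq_liftE.
Qed.

Lemma Uq_liftZ c : {morph Uq_lift : x / c *: x}.
Proof.
elim/toU_ind=> s.
by rewrite {1}/GRing.scale /= toUZ !Uq_liftE /= -scalerAl mul1r.
Qed.

Lemma Uq_lift_unique (f : {lrmorphism Uq -> A}) :
  (forall i, [/\ f (UK i) = K i, f (UKi i) = Ki i, f (UE i) = E i & f (UF i) = F i]) ->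
  f =1 Uq_lift.
Proof.
move=> h; elim/toU_ind=> t; rewrite Uq_liftE -eval_toU.
elim: t => [c|[] i /=|s IHs t IHt|s IHs t IHt] /=; try by case: (h i).
- by rewrite linearZ /= rmorph1.
- exact: etrans (rmorphD f _ _) (congr2 +%R IHs IHt).
- exact: etrans (rmorphM f _ _) (congr2 *%R IHs IHt).
Qed.

End Lift.
End QuantumGroup.
Arguments Uq {k} u.
Arguments UK {k u} i.
Arguments UKi {k u} i.
Arguments UE {k u} i.
Arguments UF {k u} i.

(* x * y in A^c is y * x in A, so an anti-automorphism of A is a morphism from A
   to A^c. *)
Section ConverseAlgebra.
Variables (k : fieldType) (A : algType k).

HB.instance Definition _ := GRing.Lmodule.copy A^c A.
HB.instance Definition _ := GRing.Lmodule_isLalgebra.Build k A^c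
  (fun a x y => @scalerAr k A a y x).
HB.instance Definition _ := GRing.Lalgebra_isAlgebra.Build k A^c
  (fun a x y => @scalerAl k A a y x).
End ConverseAlgebra.

Section SigmaTau.
Variables (k : fieldType) (u : k).

Definition sigma : Uq u -> Uq u^-1 := @Uq_lift k u (Uq u^-1) UKi UK UE UF.

Definition tau : Uq u -> Uq u := @Uq_lift k u (Uq u)^c UK UKi UF UE.

Hypothesis u0 : u != 0.

Lemma Ki_swap (A : algType k) (K Ki x : A) (c : k) : c != 0 ->
  K * Ki = 1 -> Ki * K = 1 -> K * x = c^-1 *: (x * K) -> Ki * x = c *: (x * Ki).
Proof.
move=> c0 h1 h2 h; rewrite -[x in LHS](mulr1 x) -h1 2!mulrA -[Ki * x * K]mulrA.
have -> : x * K = c *: (K * x) by rewrite h scalerA mulfV // scale1r.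
by rewrite -scalerAr -scalerAl mulrA h2 mul1r.
Qed.

Lemma sigma_rels : @sl3_rels k u (Uq u^-1) UKi UK UE UF.
Proof.
have r := Uq_rels u^-1; have [h1 h2] := (rel_KKi r, rel_KiK r).
split=> [i|i|i j ij|i|i|i j ij|i j ij|i|i j ij|i j ij|i j ij].
- exact: h2.
- exact: h1.
- have := Ki_swap (oner_neq0 k) (h1 j) (h2 j).
  move=> /(_ (UKi i)); rewrite invr1 !scale1r => ->//.
  have := Ki_swap (oner_neq0 k) (h1 i) (h2 i).
  move=> /(_ (UK j)); rewrite invr1 !scale1r => ->//; exact: (rel_KK r).
- apply: (Ki_swap _ (h1 i) (h2 i)); first by rewrite expf_neq0.
  by rewrite (rel_KE r) exprVn.
- apply: (Ki_swap _ (h1 i) (h2 i)); first by rewrite invr_eq0 expf_neq0.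
  by rewrite (rel_KF r) exprVn.
- apply: (Ki_swap _ (h1 i) (h2 i)); first by rewrite invr_eq0.
  by rewrite (rel_KE' r ij).
- by apply: (Ki_swap u0 (h1 i) (h2 i)); rewrite (rel_KF' r ij).
- by rewrite (rel_EF r) invrK -opprB invrN scaleNr -scalerN opprB.
- exact: (rel_EF' r ij).
- by have := rel_EEE r ij; rewrite invrK [_^-1 + _]addrC.
- by have := rel_FFF r ij; rewrite invrK [_^-1 + _]addrC.
Qed.

Lemma tau_rels : @sl3_rels k u (Uq u)^c UK UKi UF UE.
Proof.
have r := Uq_rels u; have [h1 h2] := (rel_KKi r, rel_KiK r).
have swap (c : k) (x y : Uq u) : c != 0 -> x = c^-1 *: y -> y = c *: x.
  by move=> c0 ->; rewrite scalerA mulfV // scale1r.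
have serre_rev (x y : Uq u) : y * x ^+ 2 - (u + u^-1) *: (x * (y * x)) + x ^+ 2 * y
    = x ^+ 2 * y - (u + u^-1) *: (x * y * x) + y * x ^+ 2.
  by rewrite addrC addrA addrAC mulrA.
split=> [i|i|i j ij|i|i|i j ij|i j ij|i|i j ij|i j ij|i j ij].
- exact: h2.
- exact: h1.
- by rewrite [LHS](rel_KK r (not_eq_sym ij)).
- by apply: (swap _ (UK i * UF i)); rewrite ?expf_neq0 //; exact: (rel_KF r).
- apply: (swap _ (UK i * UE i)); rewrite ?invr_eq0 ?expf_neq0 //.
  by rewrite invrK; exact: (rel_KE r).
- apply: (swap _ (UK i * UF j)); rewrite ?invr_eq0 //.
  by rewrite invrK; exact: (rel_KF' r ij).
- by apply: (swap _ (UK i * UE j)) => //; exact: (rel_KE' r ij).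
- exact: (rel_EF r i).
- exact: (rel_EF' r (not_eq_sym ij)).
- by apply: etrans (rel_FFF r ij); exact: serre_rev.
- by apply: etrans (rel_EEE r ij); exact: serre_rev.
Qed.

Lemma sigmaK i : sigma (UK i) = UKi i. Proof. exact: Uq_liftK sigma_rels i. Qed.
Lemma sigmaKi i : sigma (UKi i) = UK i. Proof. exact: Uq_liftKi sigma_rels i. Qed.
Lemma sigmaE i : sigma (UE i) = UE i. Proof. exact: Uq_lift_E sigma_rels i. Qed.
Lemma sigmaF i : sigma (UF i) = UF i. Proof. exact: Uq_lift_F sigma_rels i. Qed.
Lemma sigma1 : sigma 1 = 1. Proof. exact: Uq_lift1 sigma_rels. Qed.
Lemma sigmaD : {morph sigma : x y / x + y}. Proof. exact: Uq_liftD sigma_rels. Qed.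
Lemma sigmaM : {morph sigma : x y / x * y}. Proof. exact: Uq_liftM sigma_rels. Qed.
Lemma sigmaZ c : {morph sigma : x / c *: x}. Proof. exact: Uq_liftZ sigma_rels c. Qed.

Lemma tauK i : tau (UK i) = UK i. Proof. exact: Uq_liftK tau_rels i. Qed.
Lemma tauKi i : tau (UKi i) = UKi i. Proof. exact: Uq_liftKi tau_rels i. Qed.
Lemma tauE i : tau (UE i) = UF i. Proof. exact: Uq_lift_E tau_rels i. Qed.
Lemma tauF i : tau (UF i) = UE i. Proof. exact: Uq_lift_F tau_rels i. Qed.
Lemma tau1 : tau 1 = 1. Proof. exact: Uq_lift1 tau_rels. Qed.
Lemma tauD : {morph tau : x y / x + y}. Proof. exact: Uq_liftD tau_rels. Qed.
Lemma tauM x y : tau (x * y) = tau y * tau x. Proof. exact: Uq_liftM tau_rels x y. Qed.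
Lemma tauZ c : {morph tau : x / c *: x}. Proof. exact: Uq_liftZ tau_rels c. Qed.
End SigmaTau.

(* The left A-module with one generator cyclic_gen and defining relations
   x *: cyclic_gen = 0 for x in S: the quotient of A by the left ideal
   generated by S. *)
Section CyclicModule.
Variables (A : nzRingType) (S : seq A).

Definition lideal : {pred A} := fun x =>
  `[< exists c : 'I_(size S) -> A, x = \sum_(i < size S) c i * S`_i >].

Lemma lidealMl a x : x \in lideal -> a * x \in lideal.
Proof.
move=> /asboolP[c ->]; apply/asboolP; exists (fun i => a * c i).
by rewrite mulr_sumr; apply: eq_bigr => i _; rewrite mulrA.
Qed.

Lemma lideal_zmod : zmod_closed lideal.
Proof.
split=> [|x y /asboolP[c ->] /asboolP[d ->]]; apply/asboolP.
  by exists (fun=> 0); rewrite big1 // => i _; rewrite mul0r.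
exists (fun i => c i - d i); rewrite -sumrB.
by apply: eq_bigr => i _; rewrite mulrBl.
Qed.
HB.instance Definition _ := GRing.isZmodClosed.Build A lideal lideal_zmod.

Definition cyclic_mod := Quotient.quot lideal.
HB.instance Definition _ := GRing.Zmodule.on cyclic_mod.

Definition to_cyclic (x : A) : cyclic_mod := \pi x.
Definition cyclic_gen : cyclic_mod := to_cyclic 1.

Lemma to_cyclicP x y : to_cyclic x = to_cyclic y <-> x - y \in lideal.
Proof. by rewrite Quotient.idealrBE; split=> [/eqP|/eqP]. Qed.

Lemma to_cyclicD : {morph to_cyclic : x y / x + y}.
Proof. by move=> x y; rewrite /to_cyclic !piE. Qed.

Definition cyclic_scale (a : A) (x : cyclic_mod) := to_cyclic (a * repr x).

Lemma cyclic_scaleE a x : cyclic_scale a (to_cyclic x) = to_cyclic (a * x).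
Proof.
apply/to_cyclicP; rewrite -mulrBr; apply/lidealMl/to_cyclicP.
exact: (reprK (to_cyclic x)).
Qed.

Lemma cyclic_ind (P : cyclic_mod -> Prop) : (forall x, P (to_cyclic x)) -> forall x, P x.
Proof. by move=> h x; rewrite -(reprK x); exact: h. Qed.

Lemma cyclic_scaleA a b x : cyclic_scale a (cyclic_scale b x) = cyclic_scale (a * b) x.
Proof. by elim/cyclic_ind: x => x; rewrite !cyclic_scaleE mulrA. Qed.
Lemma cyclic_scale1 : left_id 1 cyclic_scale.
Proof. by elim/cyclic_ind=> x; rewrite cyclic_scaleE mul1r. Qed.
Lemma cyclic_scaleDr : right_distributive cyclic_scale +%R.
Proof.
move=> a; elim/cyclic_ind=> x; elim/cyclic_ind=> y.
by rewrite -to_cyclicD !cyclic_scaleE mulrDr to_cyclicD.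
Qed.
Lemma cyclic_scaleDl x : {morph cyclic_scale^~ x : a b / a + b}.
Proof.
by elim/cyclic_ind: x => x a b; rewrite !cyclic_scaleE mulrDl to_cyclicD.
Qed.
HB.instance Definition _ := GRing.Zmodule_isLmodule.Build A cyclic_mod
  cyclic_scaleA cyclic_scale1 cyclic_scaleDr cyclic_scaleDl.

Lemma cyclic_modP (x : cyclic_mod) : exists a, x = a *: cyclic_gen.
Proof.
by elim/cyclic_ind: x => a; exists a; rewrite [RHS]cyclic_scaleE mulr1.
Qed.

Lemma cyclic_gen_eq0 a : a *: cyclic_gen = 0 <-> a \in lideal.
Proof.
have -> : a *: cyclic_gen = to_cyclic a by rewrite [LHS]cyclic_scaleE mulr1.
have -> : 0 = to_cyclic 0 by rewrite /to_cyclic !piE.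
by rewrite to_cyclicP subr0.
Qed.
End CyclicModule.

(* A module M over a k-algebra A is a k-module through c%:A *: x. *)
Definition Verma (k : fieldType) (u c1 c2 : k) := cyclic_mod
  [:: UK node1 - c1%:A; UK node2 - c2%:A; UE node1; UE node2 : Uq u].

(* (k, a1, a2) stands for the exponent k + a1 lambda_1 + a2 lambda_2. *)
Definition expo : Type := (int * int * int)%type.
HB.instance Definition _ := GRing.Zmodule.on expo.

Definition ez (n : int) : expo := (n, 0, 0).
Definition lam1 : expo := (0, 1, 0).
Definition lam2 : expo := (0, 0, 1).
Definition lam3 : expo := - lam1 - lam2.

(* The brackets whose square root is chosen, together with [0]. *)
Definition bracket_arg (a : expo) : Prop :=
  (exists n : nat, a = ez n) \/
  (exists n : int, [\/ a = lam1 - lam2 + ez n, a = lam2 - lam3 + ez n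
                     | a = lam1 - lam3 + ez n]).

(* The coefficients below are formal products and quotients of brackets.  Taking
   br a = [a] gives their value; taking br a = sqrt [a] gives their square root,
   defined multiplicatively. *)
Section Brackets.
Variables (F : fieldType) (br : expo -> F).

Definition br_fact (a : nat) : F := \prod_(1 <= i < a.+1) br (ez i).

Definition br_poch (a : expo) (b : nat) : F := \prod_(0 <= i < b) br (a + ez i).

(* [a]_oo / [a + k]_oo *)
Definition br_poch_oo (a : expo) (k : int) : F :=
  match k with
  | Posz m => br_poch a m
  | Negz m => (br_poch (a + ez k) m.+1)^-1
  end.

Definition a_coef (d1 d2 n : int) : F :=
  br (ez (d2 - n)) * br (lam2 - lam3 + ez (d1 - d2 - n + 1)).

Definition b1_coef (d1 d2 n : int) : F :=
  (br (ez (d2 - n + 1)) * br (ez n) * br (lam2 - lam3 + ez (- n + 1))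
     * br (lam1 - lam3 + ez (- n + 2)))
  / (br (lam2 - lam3 + ez (d1 - 2 * n + 1)) * br (lam2 - lam3 + ez (d1 - 2 * n + 2))).

Definition b2_coef (d1 d2 n : int) : F :=
  (br (ez (d1 - n)) * br (lam2 - lam3 + ez (d1 - d2 - n))
     * br (lam2 - lam3 + ez (d1 - n + 1)) * br (lam1 - lam2 + ez (- d1 + n + 1)))
  / (br (lam2 - lam3 + ez (d1 - 2 * n)) * br (lam2 - lam3 + ez (d1 - 2 * n + 1))).

Definition c_coef (d1 d2 n : nat) : F :=
  1 / (br_fact (d1 - n) * br_fact (d2 - n) * br_fact n)
  * (1 / (br_poch (lam1 - lam2 + ez (- d1%:Z + n%:Z + 1)) (d1 - n)
          * br_poch (lam1 - lam3 + ez (- n%:Z + 2)) n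
          * br_poch (lam2 - lam3 + ez 2) (d1 - n)))
  * (br_poch_oo (lam2 - lam3 + ez 2) (d1%:Z - 2 * n%:Z)
     / (br_poch (lam2 - lam3 + ez (d1%:Z - d2%:Z - n%:Z + 1)) (d2 - n)
        * br_poch (lam2 - lam3 + ez (- n%:Z + 1)) n)).
End Brackets.

Definition r_expo (d1 d2 n : nat) : expo :=
  (lam2 - lam3 + ez (d1%:Z + 1)) *+ n - ez (n%:Z ^+ 2)
  + (lam1 - lam2 - ez 1) *+ d1 - ez (d1%:Z ^+ 2).

Definition s_expo (d1 d2 : nat) : expo :=
  ez (- d1%:Z ^+ 2 - d2%:Z ^+ 2 + d1%:Z * d2%:Z)
  + (lam1 - lam2) *+ d1 + (lam2 - lam3) *+ d2.

Section ICoefficient.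
Variables (F : fieldType) (q z1 z2 : F).

Definition qpoch (a : F) (n : nat) : F := \prod_(0 <= i < n) (1 - a * q ^+ i).

(* (a)_oo / (q ^ k * a)_oo *)
Definition qpoch_oo (a : F) (k : int) : F :=
  match k with
  | Posz m => qpoch a m
  | Negz m => (qpoch (q ^ k * a) m.+1)^-1
  end.

Definition I_coef (d1 d2 n : nat) : F :=
  1 / (qpoch q (d1 - n) * qpoch q (d2 - n) * qpoch q n)
  * (qpoch_oo (q * z2) (d1%:Z - 2 * n%:Z)
     / (qpoch (q * z1^-1) (d1 - n) * qpoch (q * z1^-1 * z2^-1) n
        * qpoch (q ^ (- d1%:Z + 2 * n%:Z + 1) * z2^-1) (d2 - n)
        * qpoch (q * z2) (d1 - n) * qpoch (q * z2^-1) n)).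
End ICoefficient.

Section GelfandTsetlin.
Variables (k : fieldType) (u : k) (M : lmodType (Uq u)) (w : M).
Variables (wt sq : expo -> k) (m : nat -> nat -> nat -> M).

Definition GT_index (i : nat * nat * nat) : bool := (i.2 <= minn i.1.1 i.1.2)%N.

Definition GT_comb (s : seq (nat * nat * nat)) (c : nat * nat * nat -> k) : M :=
  \sum_(i <- s) (c i)%:A *: m i.1.1 i.1.2 i.2.

Definition GT_spanning : Prop := forall x : M,
  exists (s : seq (nat * nat * nat)) (c : nat * nat * nat -> k),
    all GT_index s /\ x = GT_comb s c.

Definition GT_free : Prop :=
  forall (s : seq (nat * nat * nat)) (c : nat * nat * nat -> k),
  uniq s -> all GT_index s -> GT_comb s c = 0 -> {in s, forall i, c i = 0}.

(* wt a is the factor v ^ a by which K acts; sq is the choice of square roots.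
   Terms whose index leaves the range n <= min(d1, d2), including those where
   .-1 truncates, have a zero coefficient. *)
Record GT_basis : Prop := GTBasis {
  GT_span : GT_spanning;
  GT_indep : GT_free;
  GT_w : m 0 0 0 = w;
  GT_K1 : forall d1 d2 n, (n <= minn d1 d2)%N ->
    UK node1 *: m d1 d2 n
    = (wt (lam1 - lam2 + ez (- 2 * d1%:Z + d2%:Z)))%:A *: m d1 d2 n;
  GT_K2 : forall d1 d2 n, (n <= minn d1 d2)%N ->
    UK node2 *: m d1 d2 n
    = (wt (lam2 - lam3 + ez (- 2 * d2%:Z + d1%:Z)))%:A *: m d1 d2 n;
  GT_E1 : forall d1 d2 n, (n <= minn d1 d2)%N ->
    UE node1 *: m d1 d2 n
    = (b1_coef sq d1 d2 n)%:A *: m d1.-1 d2 n.-1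
      + (b2_coef sq d1 d2 n)%:A *: m d1.-1 d2 n;
  GT_F1 : forall d1 d2 n, (n <= minn d1 d2)%N ->
    UF node1 *: m d1 d2 n
    = (b1_coef sq d1.+1 d2 n.+1)%:A *: m d1.+1 d2 n.+1
      + (b2_coef sq d1.+1 d2 n)%:A *: m d1.+1 d2 n;
  GT_E2 : forall d1 d2 n, (n <= minn d1 d2)%N ->
    UE node2 *: m d1 d2 n = (a_coef sq d1 d2 n)%:A *: m d1 d2.-1 n;
  GT_F2 : forall d1 d2 n, (n <= minn d1 d2)%N ->
    UF node2 *: m d1 d2 n = (a_coef sq d1 d2.+1 n)%:A *: m d1 d2.+1 n
}.
End GelfandTsetlin.

(* The variables 'X_0, 'X_1, 'X_2 are v, v^lambda_1, v^lambda_2. *)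
Definition ratfun (R : realType) := {fraction {mpoly R[i][3]}}.
HB.instance Definition _ (R : realType) := GRing.Field.on (ratfun R).

Definition ratfun_var (R : realType) (i : 'I_3) : ratfun R :=
  tofrac ('X_i : {mpoly R[i][3]}).

Section Setting.
Variables (R : realType) (Omega : closedFieldType) (iota : {rmorphism ratfun R -> Omega}).

Definition qv : sqrt_ring iota := sqrt_ring_in iota (ratfun_var R 0).
Definition qlam1 : sqrt_ring iota := sqrt_ring_in iota (ratfun_var R 1).
Definition qlam2 : sqrt_ring iota := sqrt_ring_in iota (ratfun_var R 2).

(* v ^ a *)
Definition vpow (a : expo) : sqrt_ring iota :=
  qv ^ a.1.1 * qlam1 ^ a.1.2 * qlam2 ^ a.2.

Definition qint (a : expo) : sqrt_ring iota := (vpow a - vpow (- a)) / (qv - qv^-1).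

Definition sqrt_choice (sq : expo -> sqrt_ring iota) : Prop :=
  sq 0 = 0 /\ forall a, bracket_arg a -> sq a ^+ 2 = qint a.

(* The coefficients are extended from C(v) to sqrt_ring iota: Uq qv is presented
   over sqrt_ring iota by the generators and relations of U_v(sl_3). *)
Definition Verma_v := Verma qv (vpow (lam1 - lam2)) (vpow (lam2 - lam3)).
Definition Verma_vbar := Verma qv^-1 (vpow (lam2 - lam1)) (vpow (lam3 - lam2)).

Definition w_v : Verma_v := cyclic_gen _.
Definition w_vbar : Verma_vbar := cyclic_gen _.

Record Verma_pairing (B : Verma_v -> Verma_vbar -> sqrt_ring iota) : Prop :=
    VermaPairing {
  pairing_linl : forall c x x' y, B (c%:A *: x + x') y = c * B x y + B x' y;
  pairing_linr : forall c x y y', B x (c%:A *: y + y') = c * B x y + B x y';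
  pairing_ndl : forall x, (forall y, B x y = 0) -> x = 0;
  pairing_ndr : forall y, (forall x, B x y = 0) -> y = 0;
  pairing_w : B w_v w_vbar = 1;
  pairing_adj : forall (g : Uq qv) x y, B (g *: x) y = B x (sigma (tau g) *: y)
}.

Definition omega (sq : expo -> sqrt_ring iota) (m : nat -> nat -> nat -> Verma_v)
    (d1 d2 n : nat) : Verma_v :=
  (vpow (r_expo d1 d2 n) / (1 - qv ^+ 2) ^+ (d1 + d2) * c_coef sq d1 d2 n)%:A
  *: m d1 d2 n.

Definition omega_bar (sq : expo -> sqrt_ring iota)
    (mbar : nat -> nat -> nat -> Verma_vbar) (d1 d2 n : nat) : Verma_vbar :=
  (vpow (- r_expo d1 d2 n + s_expo d1 d2) / (1 - qv ^- 2) ^+ (d1 + d2)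
     * c_coef sq d1 d2 n)%:A
  *: mbar d1 d2 n.
End Setting.
Arguments qv {R Omega} iota.
Arguments vpow {R Omega} iota a.
Arguments Verma_v {R Omega} iota.
Arguments Verma_vbar {R Omega} iota.
Arguments w_v {R Omega} iota.
Arguments w_vbar {R Omega} iota.

(* Main.v *)
From HB Require Import structures.
Require Import Defs.
From mathcomp Require Import all_boot all_order all_algebra.
From mathcomp Require Import reals complex mpoly.
From mathcomp Require Import ring zify.

Set Implicit Arguments.
Unset Strict Implicit.
Unset Printing Implicit Defensive.

Import GRing.Theory.
Local Open Scope ring_scope.

(** The theorem holds because the two Gelfand-Tsetlin bases are dual to each
other under the pairing, so that the right-hand side is just the product of
the two scalar factors of the components, and this product is a rewriting of
the coefficient I.

Duality ([GT_dual]).  In a Gelfand-Tsetlin basis the matrices of E_i and F_i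
are transposes of each other, the same square roots occurring in both.  The
adjunction (F_i x, y) = (x, E_i y) therefore says that the numbers
(m_I, mbar_J), as functions of I, satisfy the recurrences that the Kronecker
symbol satisfies.  These recurrences determine them from (w, mbar_J), since
every m_I other than w is reached from basis vectors preceding it by dividing
by a matrix entry of F_1 or F_2 that is not zero ([GT_ind]); and (w, mbar_J)
vanishes for J other than (0,0,0) because mbar_J lies in the sum of the images
of F_1 and F_2 while E_1 w = E_2 w = 0.  The division is possible because no
bracket [a] with a <> 0 vanishes, that is, because distinct exponents give
distinct Laurent monomials in v, v^lambda_1, v^lambda_2 ([laurent_eq1]).

Scalars ([I_coefE]).  The powers v^r and v^(-r) cancel, and the product of the
two square roots of c is c ([c_coef_sqr]).  On the side of I, each factor is
1 - v^(2a) = - v^a (v - v^(-1)) [a].  Factors with z_1^(-1) or z_2^(-1) have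
a negated exponent: reading the product backwards turns them into the
brackets of c, up to a sign.  The brackets then agree one by one; the powers
of v add up to v^s; and there remain d_1 + d_2 signs and 2 (d_1 + d_2) factors
v - v^(-1), which are the denominators (1 - v^2)^(d_1+d_2)
(1 - v^(-2))^(d_1+d_2). *)

(** * Exponents *)

Lemma expoP (a b : expo) :
  a.1.1 = b.1.1 -> a.1.2 = b.1.2 -> a.2 = b.2 -> a = b.
Proof. by case: a b => [[? ?] ?] [[? ?] ?] /= -> -> ->. Qed.

Lemma expoMnE (a : expo) n : a *+ n = (a.1.1 *+ n, a.1.2 *+ n, a.2 *+ n).
Proof. by elim: n => [//|n IH]; rewrite !mulrS IH. Qed.

Lemma expoMzE (a : expo) (k : int) : a *~ k = (a.1.1 * k, a.1.2 * k, a.2 * k).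
Proof.
case: k => n; first by rewrite -pmulrn expoMnE; congr (_, _, _); lia.
by rewrite NegzE mulrNz -pmulrn expoMnE; apply: expoP => /=; lia.
Qed.

Ltac expo_lia := apply: expoP; rewrite ?expoMnE /=; lia.

(** The polynomial k (k - 1) / 2 at an integer k: the sum of 0, ..., k - 1 for
k >= 0, and minus the sum of k, ..., -1 for k < 0.  It is the total of the shifts i in
the factors 1 - q^i a of (a)_oo / (q^k a)_oo, those in the denominator counting
negatively. *)
Definition binz2 (k : int) : int :=
  match k with Posz m => 'C(m, 2)%:Z | Negz m => 'C(m.+2, 2)%:Z end.

Lemma binz2_double k : binz2 k * 2 = k * (k - 1).
Proof.
have h (n : nat) : 'C(n, 2)%:Z * 2 = n%:Z * (n%:Z - 1).
  by elim: n => [//|n IH]; rewrite binS bin1; lia.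
by case: k => m /=; rewrite h; lia.
Qed.

(** * Pochhammer symbols as products of brackets *)

Section Scalars.
Variables (F : fieldType) (wt : expo -> F).
Hypothesis wtD : {morph wt : a b / a + b >-> a * b}.
Hypothesis wt_neq0 : forall a, wt a != 0.
Let v := wt (ez 1).
Let delta := v - v^-1.
Hypothesis delta_neq0 : delta != 0.
Let br (a : expo) : F := (wt a - wt (- a)) / delta.

Lemma wt0 : wt 0 = 1.
Proof. by apply: (mulfI (wt_neq0 0)); rewrite -wtD addr0 mulr1. Qed.

Lemma wtN a : wt (- a) = (wt a)^-1.
Proof. by apply: (mulfI (wt_neq0 a)); rewrite -wtD subrr wt0 mulfV. Qed.

Lemma wtMn a n : wt (a *+ n) = wt a ^+ n.
Proof. by elim: n => [|n IH]; rewrite ?wt0 // mulrS exprS wtD IH. Qed.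

Lemma wtMz a (k : int) : wt (a *~ k) = wt a ^ k.
Proof. by case: k => k; [exact: wtMn|rewrite NegzE mulrNz wtN wtMn]. Qed.

Lemma one_sub_wt a : 1 - wt (a *+ 2) = wt a * - delta * br a.
Proof.
rewrite /br wtN mulr2n wtD; field.
by rewrite delta_neq0 wt_neq0.
Qed.

Lemma brN a : br (- a) = - br a.
Proof. by rewrite /br opprK -mulNr opprB. Qed.

Lemma qpochE a n : qpoch (v ^+ 2) (wt (a *+ 2)) n
  = wt (a *+ n + ez 'C(n, 2)) * (- delta) ^+ n * br_poch br a n.
Proof.
elim: n => [|n IH].
  by rewrite /qpoch /br_poch !big_geq // addr0 wt0 expr0 !mulr1.
rewrite /qpoch /br_poch !big_nat_recr //= -/(qpoch _ _ _) -/(br_poch _ _ _) IH.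
have -> : wt (a *+ 2) * (v ^+ 2) ^+ n = wt ((a + ez n) *+ 2).
  by rewrite /v -!wtMn -wtD; congr wt; expo_lia.
rewrite one_sub_wt binS bin1.
have -> : a *+ n.+1 + ez ('C(n, 2) + n)%N = (a *+ n + ez 'C(n, 2)) + (a + ez n).
  by expo_lia.
rewrite [in RHS]wtD exprS; set W := wt (_ + ez _); ring.
Qed.

Lemma br_pochN a n :
  br_poch br (- a) n = (-1) ^+ n * br_poch br (a + ez (1 - n%:Z)) n.
Proof.
rewrite /br_poch [in RHS]big_nat_rev /= add0n -{2}(subn0 n) -prodr_const_nat.
rewrite -big_split /=; apply: eq_big_nat => i /andP[_ lt_in].
rewrite mulN1r -brN; congr br; expo_lia.
Qed.

(** With the exponents negated, the brackets run through the same range backwards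
and the n signs turn each - delta into delta. *)
Lemma qpochNE a n : qpoch (v ^+ 2) (wt (- a *+ 2)) n
  = wt (- a *+ n + ez 'C(n, 2)) * delta ^+ n * br_poch br (a + ez (1 - n%:Z)) n.
Proof.
rewrite qpochE br_pochN [_ * (_ * br_poch _ _ _)]mulrA.
by rewrite -[_ * (-1) ^+ n]mulrA -exprMn mulNr mulrN1 opprK.
Qed.

Lemma qpoch_ooE a k : qpoch_oo (v ^+ 2) (wt (a *+ 2)) k
  = wt (a *~ k + ez (binz2 k)) * (- delta) ^ k * br_poch_oo br a k.
Proof.
case: k => m; first exact: qpochE.
rewrite /qpoch_oo /br_poch_oo.
have -> : (v ^+ 2) ^ Negz m * wt (a *+ 2) = wt ((a + ez (Negz m)) *+ 2).
  by rewrite NegzE /v -!wtMn -exprnN -wtMn -wtN -wtD; congr wt; expo_lia.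
rewrite qpochE !invfM -wtN NegzE -exprnN; congr (wt _ * _ * _).
have b1 := binz2_double m.+1; have b2 := binz2_double m.+2.
by rewrite /binz2 in b1 b2; apply: expoP; rewrite ?expoMnE ?expoMzE /=; lia.
Qed.

(** Factor by factor, I and c contain the same brackets; what is left is an identity
between exponents of v, which gives s, and a count of the factors delta and
- delta. *)
Lemma I_coefE d1 d2 n : (n <= minn d1 d2)%N ->
  I_coef (v ^+ 2) (wt ((lam1 - lam2 + ez 1) *+ 2))
    (wt ((lam2 - lam3 + ez 1) *+ 2)) d1 d2 n
  = wt (s_expo d1 d2) / ((1 - v ^+ 2) ^+ (d1 + d2) * (1 - v ^- 2) ^+ (d1 + d2))
    * c_coef br d1 d2 n.
Proof.
rewrite leq_min => /andP[/subnK <- /subnK <-].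
rewrite /I_coef /c_coef; move: (d1 - n)%N (d2 - n)%N => d e; rewrite !addnK.
have wq : v ^+ 2 = wt (ez 1 *+ 2) by rewrite wtMn.
have wqz k : (v ^+ 2) ^ k = wt (ez k *+ 2).
  rewrite wq -wtMz; congr wt; apply: expoP; rewrite ?expoMzE ?expoMnE /=; lia.
rewrite wqz -!wtN.
pose l12 := lam1 - lam2; pose l23 := lam2 - lam3; pose l13 := lam1 - lam3.
have -> : v ^+ 2 * wt (- ((lam1 - lam2 + ez 1) *+ 2)) = wt (- l12 *+ 2).
  by rewrite wq -wtD; congr wt; expo_lia.
have -> : wt (- l12 *+ 2) * wt (- ((lam2 - lam3 + ez 1) *+ 2)) = wt (- (l13 + ez 1) *+ 2).
  by rewrite -wtD; congr wt; expo_lia.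
have -> : wt (ez (- (d + n)%N%:Z + 2 * n%:Z + 1) *+ 2) * wt (- ((lam2 - lam3 + ez 1) *+ 2))
    = wt (- (l23 + ez ((d + n)%N%:Z - 2 * n%:Z)) *+ 2).
  by rewrite -wtD; congr wt; expo_lia.
have -> : v ^+ 2 * wt ((lam2 - lam3 + ez 1) *+ 2) = wt ((l23 + ez 2) *+ 2).
  by rewrite wq -wtD; congr wt; expo_lia.
have -> : v ^+ 2 * wt (- ((lam2 - lam3 + ez 1) *+ 2)) = wt (- l23 *+ 2).
  by rewrite wq -wtD; congr wt; expo_lia.
have fact k : qpoch (v ^+ 2) (v ^+ 2) k
    = wt (ez 1 *+ k + ez 'C(k, 2)) * (- delta) ^+ k * br_fact br k.
  rewrite {2}wq qpochE; congr (_ * _).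
  rewrite /br_poch /br_fact big_add1 /=; apply: eq_bigr => i _.
  by congr br; expo_lia.
rewrite !fact !qpochNE qpoch_ooE qpochE.
rewrite -/l12 -/l13 -/l23.
have -> : l12 + ez (1 - d%:Z) = l12 + ez (- (d + n)%N%:Z + n%:Z + 1) by expo_lia.
have -> : l13 + ez 1 + ez (1 - n%:Z) = l13 + ez (- n%:Z + 2) by expo_lia.
have -> : l23 + ez ((d + n)%N%:Z - 2 * n%:Z) + ez (1 - e%:Z)
   = l23 + ez ((d + n)%N%:Z - (e + n)%N%:Z - n%:Z + 1) by expo_lia.
have -> : l23 + ez (1 - n%:Z) = l23 + ez (- n%:Z + 1) by expo_lia.
(* 1 - v^2 = v * - delta and 1 - v^-2 = v^-1 * delta *)
have delta_v : (1 - v ^+ 2) ^+ (d + n + (e + n)) * (1 - v ^- 2) ^+ (d + n + (e + n))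
    = (- delta) ^+ (d + n + (e + n)) * delta ^+ (d + n + (e + n)).
  rewrite -!exprMn; congr (_ ^+ _); rewrite /delta.
  have := wt_neq0 (ez 1); rewrite -/v => v0; by field.
rewrite delta_v.
have -> : wt ((l23 + ez 2) *~ ((d + n)%N%:Z - 2 * n%:Z)
              + ez (binz2 ((d + n)%N%:Z - 2 * n%:Z)))
  = wt (s_expo (d + n) (e + n))
    * (wt (ez 1 *+ d + ez 'C(d, 2))
       * wt (ez 1 *+ e + ez 'C(e, 2))
       * wt (ez 1 *+ n + ez 'C(n, 2))
       * wt (- l12 *+ d + ez 'C(d, 2))
       * wt (- (l13 + ez 1) *+ n + ez 'C(n, 2))
       * wt (- (l23 + ez ((d + n)%N%:Z - 2 * n%:Z)) *+ e + ez 'C(e, 2))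
       * wt ((l23 + ez 2) *+ d + ez 'C(d, 2))
       * wt (- l23 *+ n + ez 'C(n, 2))).
  rewrite -!wtD; congr wt.
  have t0 := binz2_double ((d + n)%N%:Z - 2 * n%:Z).
  have t1 := binz2_double d; have t2 := binz2_double e; have t3 := binz2_double n.
  rewrite /= in t1 t2 t3; set t := binz2 _ in t0 *.
  apply: expoP; rewrite ?expoMzE ?expoMnE /= ?expoMnE /=; lia.
have nd0 : - delta != 0 by rewrite oppr_eq0.
have -> : (- delta) ^ ((d + n)%N%:Z - 2 * n%:Z)
  = (- delta) ^+ d * (- delta) ^+ e * (- delta) ^+ n
    * delta ^+ d * delta ^+ n * delta ^+ e * (- delta) ^+ d
    * delta ^+ n / ((- delta) ^+ (d + n + (e + n)) * delta ^+ (d + n + (e + n))).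
  apply: (canRL (mulfK _)); first by rewrite mulf_neq0 ?expf_neq0.
  rewrite mulrA.
  transitivity ((- delta) ^+ (d + e + n + d) * delta ^+ (d + n + e + n)).
    rewrite !exprnP -expfzDr //; congr (_ ^ _ * _ ^ _); lia.
  rewrite !exprD; ring.
rewrite !invfM !mul1r.
(* The products of brackets may vanish in F, so their inverses are made into
   variables before the identity is left to the field axioms. *)
have exN k : (- delta) ^+ k != 0 by rewrite expf_neq0.
have exD k : delta ^+ k != 0 by rewrite expf_neq0.
repeat match goal with
| |- context [wt ?x] => move: (wt x) (wt_neq0 x) => ? ?
| |- context [(- delta) ^+ ?k] => move: ((- delta) ^+ k) (exN k) => ? ?
| |- context [delta ^+ ?k] => move: (delta ^+ k) (exD k) => ? ?
| |- context [(br_fact br ?k)^-1] => move: (br_fact br k)^-1 => ?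
| |- context [(br_poch br ?a ?k)^-1] => move: (br_poch br a k)^-1 => ?
| |- context [br_poch_oo br ?a ?k] => move: (br_poch_oo br a k) => ?
end.
field.
repeat (apply/andP; split); assumption.
Qed.
End Scalars.

(** * Square roots of products of brackets *)

Section SquareRoots.
Variables (F : fieldType) (sq br : expo -> F).
Hypothesis sqE : forall a, bracket_arg a -> sq a ^+ 2 = br a.

Lemma br_fact_sqr k : br_fact sq k ^+ 2 = br_fact br k.
Proof.
by rewrite -prodrXl; apply: eq_bigr => i _; apply: sqE; left; exists i.
Qed.

Lemma br_poch_sqr a k : (forall n, bracket_arg (a + ez n)) ->
  br_poch sq a k ^+ 2 = br_poch br a k.
Proof. by move=> ha; rewrite -prodrXl; apply: eq_bigr => i _; apply: sqE. Qed.

Lemma br_poch_oo_sqr a k : (forall n, bracket_arg (a + ez n)) ->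
  br_poch_oo sq a k ^+ 2 = br_poch_oo br a k.
Proof.
move=> ha; case: k => k /=; first exact: br_poch_sqr.
rewrite exprVn br_poch_sqr // => n.
by have -> : a + ez (Negz k) + ez n = a + ez (Negz k + n) by expo_lia.
Qed.

Lemma c_coef_sqr d1 d2 n : c_coef sq d1 d2 n ^+ 2 = c_coef br d1 d2 n.
Proof.
have ezz a x y : a + ez x + ez y = a + ez (x + y) by expo_lia.
have h12 x y : bracket_arg (lam1 - lam2 + ez x + ez y).
  by rewrite ezz; right; exists (x + y); apply: Or31.
have h23 x y : bracket_arg (lam2 - lam3 + ez x + ez y).
  by rewrite ezz; right; exists (x + y); apply: Or32.
have h13 x y : bracket_arg (lam1 - lam3 + ez x + ez y).
  by rewrite ezz; right; exists (x + y); apply: Or33.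
rewrite /c_coef !(exprMn, exprVn, expr1n) !br_fact_sqr br_poch_oo_sqr //.
by rewrite !br_poch_sqr.
Qed.
End SquareRoots.

(** * Duality of the Gelfand-Tsetlin bases *)

(** Induction along the arrows with non-zero matrix entries: F_2 reaches every
index with n < d2, F_1 alone reaches (d, 0, 0) from (d - 1, 0, 0), and for n = d2 > 0
F_1 maps m_(d1 - 1, n, n - 1) to a combination of m_(d1, n, n) and m_(d1, n, n - 1),
the second of which F_2 has already reached. *)
Lemma GT_ind (P : nat -> nat -> nat -> Prop) :
  P 0 0 0 ->
  (forall d1 d2 n, (n <= minn d1 d2)%N -> P d1 d2 n -> P d1 d2.+1 n) ->
  (forall d, P d 0 0 -> P d.+1 0 0) ->
  (forall d n, (n <= d)%N -> P d n.+1 n -> P d.+1 n.+1 n -> P d.+1 n.+1 n.+1) ->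
  forall d1 d2 n, (n <= minn d1 d2)%N -> P d1 d2 n.
Proof.
move=> P0 P2 P1 P12 d1 d2 n; move: {2}(d1 + d2)%N (erefl (d1 + d2)%N) => N.
elim: N d1 d2 n => [|N IH] d1 d2 n eN le_n.
  by have -> : d1 = 0 by [lia]; have -> : d2 = 0 by [lia]; have -> : n = 0 by lia.
have P2' d1' d2' n' : (d1' + d2' = N.+1 -> n' <= d1' -> n' < d2' -> P d1' d2' n')%N.
  case: d2' => // d2' eN' le1 le2; apply: P2; first by lia.
  by apply: IH; lia.
have [lt_n|le_d2n] := ltnP n d2; first by apply: P2' => //; lia.
have e2 : d2 = n by lia.
case: n => [|n] in le_n le_d2n e2 *; case: d1 => [|d1] in eN le_n *; subst d2; try lia.
  by apply: P1; apply: IH; lia.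
by apply: P12; [lia | apply: IH; lia | apply: P2'; lia].
Qed.

Section Duality.
Variables (k : fieldType) (u : k).
Variables (M : lmodType (Uq u)) (M' : lmodType (Uq u^-1)) (w : M) (w' : M').
Variables (wt wt' sq : expo -> k).
Variables (m : nat -> nat -> nat -> M) (m' : nat -> nat -> nat -> M').
Hypotheses (mP : GT_basis w wt sq m) (m'P : GT_basis w' wt' sq m').
Variable B : M -> M' -> k.
Hypothesis Bl : forall c x x' y, B (c%:A *: x + x') y = c * B x y + B x' y.
Hypothesis Br : forall c x y y', B x (c%:A *: y + y') = c * B x y + B x y'.
Hypothesis Bw : B w w' = 1.
Hypothesis BE : forall i x y, B (UE i *: x) y = B x (UF i *: y).
Hypothesis BF : forall i x y, B (UF i *: x) y = B x (UE i *: y).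
Hypothesis sq0 : sq 0 = 0.
Hypothesis sq_neq0 : forall a, bracket_arg a -> a != 0 -> sq a != 0.

Lemma pairing0l y : B 0 y = 0.
Proof.
have := Bl 1 0 0 y; rewrite scaler0 addr0 mul1r => h.
by apply: (addrI (B 0 y)); rewrite addr0 -h.
Qed.

Lemma pairing0r x : B x 0 = 0.
Proof.
have := Br 1 x 0 0; rewrite scaler0 addr0 mul1r => h.
by apply: (addrI (B x 0)); rewrite addr0 -h.
Qed.

Lemma pairingZl c x y : B (c%:A *: x) y = c * B x y.
Proof. by rewrite -[_ *: x]addr0 Bl pairing0l addr0. Qed.

Lemma pairingZr c x y : B x (c%:A *: y) = c * B x y.
Proof. by rewrite -[_ *: y]addr0 Br pairing0r addr0. Qed.

Lemma sq_ez_neq0 (n : nat) : (0 < n)%N -> sq (ez n) != 0.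
Proof. by case: n => // n _; apply: sq_neq0 => //; left; exists n.+1. Qed.

Lemma sq12_neq0 n : sq (lam1 - lam2 + ez n) != 0.
Proof.
apply: sq_neq0; last by rewrite !xpair_eqE /= andbF.
by right; exists n; apply: Or31.
Qed.

Lemma sq23_neq0 n : sq (lam2 - lam3 + ez n) != 0.
Proof.
apply: sq_neq0; last by rewrite !xpair_eqE /= andbF.
by right; exists n; apply: Or32.
Qed.

Lemma sq13_neq0 n : sq (lam1 - lam3 + ez n) != 0.
Proof.
apply: sq_neq0; last by rewrite !xpair_eqE /= andbF.
by right; exists n; apply: Or33.
Qed.

Lemma sq_ez_eq0 (n : int) : n = 0 -> sq (ez n) = 0.
Proof. by move=> ->; rewrite -[RHS]sq0; congr sq; apply: expoP. Qed.

Lemma a_coef_eq0 (d1 d2 n : int) : n = d2 -> a_coef sq d1 d2 n = 0.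
Proof. by move=> ->; rewrite /a_coef sq_ez_eq0 ?mul0r ?subrr. Qed.

Lemma b1_coef_eq0 (d1 d2 n : int) : n = 0 \/ n = d2 + 1 -> b1_coef sq d1 d2 n = 0.
Proof.
rewrite /b1_coef => -[->|->].
  by rewrite [sq (ez 0)]sq_ez_eq0 // mulr0 !mul0r.
by rewrite [sq (ez (d2 - _ + 1))]sq_ez_eq0 ?mul0r //; lia.
Qed.

Lemma b2_coef_eq0 (d1 d2 n : int) : n = d1 -> b2_coef sq d1 d2 n = 0.
Proof. by move=> ->; rewrite /b2_coef sq_ez_eq0 ?subrr ?mul0r. Qed.

Lemma a_coef_neq0 (d1 d2 n : nat) : (n < d2)%N -> a_coef sq d1 d2 n != 0.
Proof.
by move=> lt_n; rewrite mulf_neq0 ?sq23_neq0 // subzn 1?ltnW // sq_ez_neq0 // subn_gt0.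
Qed.

Lemma b1_coef_neq0 (d1 d2 n : nat) : (0 < n <= d2)%N -> b1_coef sq d1 d2 n != 0.
Proof.
case/andP=> n0 le_n; have e : d2%:Z - n%:Z + 1 = (d2 - n).+1 by lia.
by rewrite /b1_coef e !(mulf_neq0, invr_eq0) ?sq_ez_neq0 ?sq23_neq0 ?sq13_neq0.
Qed.

Lemma b2_coef_neq0 (d1 d2 n : nat) : (n < d1)%N -> b2_coef sq d1 d2 n != 0.
Proof.
move=> lt_n; have e : d1%:Z - n%:Z = (d1 - n)%N by lia.
by rewrite /b2_coef e !(mulf_neq0, invr_eq0) ?sq_ez_neq0 ?sq23_neq0 ?sq12_neq0 ?subn_gt0.
Qed.

Let kron (i j : nat * nat * nat) : k := (i == j)%:R.

Definition dual_at d1 d2 n := forall e1 e2 p, (p <= minn e1 e2)%N ->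
  B (m d1 d2 n) (m' e1 e2 p) = kron (d1, d2, n) (e1, e2, p).

(** The recurrence of the Kronecker symbol along F_2: by adjunction m_I is paired with
E_2 mbar_J, whose one entry is that of F_2 because the matrices are transposed.
When the target of E_2 leaves the index set, its entry is zero. *)
Lemma pairing_F2 d1 d2 n e1 e2 p : (n <= minn d1 d2)%N -> (p <= minn e1 e2)%N ->
  dual_at d1 d2 n ->
  B (UF node2 *: m d1 d2 n) (m' e1 e2 p)
  = a_coef sq d1 d2.+1 n * kron (d1, d2.+1, n) (e1, e2, p).
Proof.
move=> len lep h; rewrite BF (GT_E2 m'P) // pairingZr.
have [e2p|e2p] := eqVneq p e2.
  rewrite a_coef_eq0 1?e2p // mul0r /kron; case: eqP => [[]|]; rewrite ?mulr0 //; lia.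
case: e2 e2p lep => [|e2] e2p lep; first by lia.
rewrite h /=; last by lia.
rewrite /kron !xpair_eqE eqSS; case: andP => [[/andP[/eqP-> /eqP->] /eqP->] //|_].
by rewrite !mulr0.
Qed.

Lemma pairing_F1 d1 d2 n e1 e2 p : (n <= minn d1 d2)%N -> (p <= minn e1 e2)%N ->
  dual_at d1 d2 n ->
  B (UF node1 *: m d1 d2 n) (m' e1 e2 p)
  = b1_coef sq d1.+1 d2 n.+1 * kron (d1.+1, d2, n.+1) (e1, e2, p)
    + b2_coef sq d1.+1 d2 n * kron (d1.+1, d2, n) (e1, e2, p).
Proof.
move=> len lep h; rewrite BF (GT_E1 m'P) // Br pairingZr; congr (_ + _).
- case: p => [|p] in lep *.
    by rewrite b1_coef_eq0; [rewrite mul0r /kron xpair_eqE andbF mulr0|left].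
  case: e1 => [|e1] in lep *; first by lia.
  rewrite h /=; last by lia.
  rewrite /kron !xpair_eqE !eqSS; case: andP => [[/andP[/eqP-> /eqP->] /eqP->] //|_].
  by rewrite !mulr0.
- have [e1p|e1p] := eqVneq p e1.
    rewrite b2_coef_eq0 1?e1p // mul0r /kron; case: eqP => [[]|]; rewrite ?mulr0 //; lia.
  case: e1 => [|e1] in lep e1p *; first by lia.
  rewrite h /=; last by lia.
  rewrite /kron !xpair_eqE !eqSS; case: andP => [[/andP[/eqP-> /eqP->] /eqP->] //|_].
  by rewrite !mulr0.
Qed.

Lemma pairing_w_UF i y : B w (UF i *: y) = 0.
Proof.
rewrite -BE -(GT_w mP); case: i.
  rewrite (GT_E1 mP) // Bl pairingZl b1_coef_eq0; last by left.
  by rewrite b2_coef_eq0 // !mul0r addr0.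
by rewrite (GT_E2 mP) // pairingZl a_coef_eq0 // mul0r.
Qed.

(** [GT_ind] applied to mbar: each mbar_J of positive degree is a combination of values
of F_1 and F_2, and w is orthogonal to these. *)
Lemma pairing_w_eq0 d1 d2 n : (n <= minn d1 d2)%N -> (0 < d1 + d2)%N ->
  B w (m' d1 d2 n) = 0.
Proof.
pose P d1 d2 n := (0 < d1 + d2)%N -> B w (m' d1 d2 n) = 0.
apply: (@GT_ind P) => [//|{}d1 {}d2 {}n len _ _|d _ _|d {}n len _ IH _].
- apply: (mulfI (@a_coef_neq0 d1 d2.+1 n _)); first by lia.
  by rewrite -pairingZr -(GT_F2 m'P) // pairing_w_UF mulr0.
- apply: (mulfI (@b2_coef_neq0 d.+1 0 0 _)) => //.
  rewrite [RHS]mulr0 -(pairing_w_UF node1 (m' d 0 0)) (GT_F1 m'P) // Br pairingZr.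
  by rewrite b1_coef_eq0 ?mul0r ?add0r //; right.
- apply: (mulfI (@b1_coef_neq0 d.+1 n.+1 n.+1 _)); first by lia.
  rewrite [RHS]mulr0 -(pairing_w_UF node1 (m' d n.+1 n)) (GT_F1 m'P); last by lia.
  by rewrite Br pairingZr IH // mulr0 addr0.
Qed.

(** In each step of [GT_ind] the recurrence is divided by the non-zero entry of the new
basis vector; in the last one the term of the vector already treated is first
subtracted from both sides. *)
Lemma GT_dual d1 d2 n : (n <= minn d1 d2)%N -> dual_at d1 d2 n.
Proof.
apply: GT_ind => [|{}d1 {}d2 {}n len IH|d IH|d {}n len IH1 IH2] e1 e2 p lep.
- rewrite (GT_w mP) /kron; have [e0|e0] := posnP (e1 + e2)%N; last first.
    by rewrite pairing_w_eq0 //; case: eqP => [[]|//]; lia.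
  have [-> -> ->] : [/\ e1 = 0, e2 = 0 & p = 0]%N by split; lia.
  by rewrite (GT_w m'P) Bw.
- apply: (mulfI (@a_coef_neq0 d1 d2.+1 n _)); first by lia.
  by rewrite -pairingZl -(GT_F2 mP) // pairing_F2.
- apply: (mulfI (@b2_coef_neq0 d.+1 0 0 _)) => //.
  have := pairing_F1 _ lep IH; rewrite (GT_F1 mP) // Bl pairingZl.
  by rewrite b1_coef_eq0 ?mul0r ?add0r; [apply|right].
- apply: (mulfI (@b1_coef_neq0 d.+1 n.+1 n.+1 _)); first by lia.
  have := pairing_F1 _ lep IH1; rewrite (GT_F1 mP); last by lia.
  rewrite Bl pairingZl IH2 // => e; apply: (addIr _); apply: e; lia.
Qed.
End Duality.

(** * Laurent monomials in v, v^lambda_1 and v^lambda_2 *)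

Section Laurent.
Variable R : realType.

Definition laurent (a : expo) : ratfun R :=
  ratfun_var R 0 ^ a.1.1 * ratfun_var R 1 ^ a.1.2 * ratfun_var R 2 ^ a.2.

Lemma ratfun_var_neq0 i : ratfun_var R i != 0.
Proof.
rewrite /ratfun_var tofrac_eq0; apply/eqP => /(congr1 (mcoeff U_(i))) /eqP.
by rewrite mcoeffX mcoeff0 eqxx oner_eq0.
Qed.

Lemma laurentD : {morph laurent : a b / a + b >-> a * b}.
Proof.
move=> a b; rewrite /laurent !expfzDr ?ratfun_var_neq0 //=; ring.
Qed.

Definition mon3 (a : nat * nat * nat) : 'X_{1.. 3} :=
  [multinom nth 0%N [:: a.1.1; a.1.2; a.2] i | i < 3].

Lemma laurent_nat (a b c : nat) : laurent (a%:Z, b%:Z, c%:Z) = tofrac 'X_[mon3 (a, b, c)].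
Proof.
rewrite /laurent /ratfun_var /= -!exprnP -!tofracXn -!tofracM !mpolyXn -!mpolyXD.
congr (tofrac 'X_[_]); apply/mnmP => i; rewrite !mnmDE !mulmnE !mnm1E mnmE /=.
by case: i => [[|[|[|i]]] lt_i] //=; lia.
Qed.

(** Moving negative powers to the other side leaves an equality of two monomials of
the polynomial ring, hence of their exponents. *)
Lemma laurent_eq1 a : laurent a = 1 -> a = 0.
Proof.
have split_int (z : int) : {p : nat * nat | z = p.1%:Z - p.2%:Z}.
  by case: z => n; [exists (n, 0%N)|exists (0%N, n.+1)]; rewrite /=; lia.
case: a => [[x y] z]; have [[x1 x2] ->] := split_int x.
have [[y1 y2] ->] := split_int y; have [[z1 z2] ->] := split_int z => a1.
have : laurent (x1%:Z, y1%:Z, z1%:Z) = laurent (x2%:Z, y2%:Z, z2%:Z).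
  rewrite -[RHS]mul1r -a1 -laurentD; congr laurent; expo_lia.
rewrite !laurent_nat => /eqP; rewrite tofrac_eq => /eqP.
move/(congr1 (mcoeff (mon3 (x1, y1, z1)))).
rewrite !mcoeffX eqxx; case: eqP => [/mnmP e _|_ /eqP]; last by rewrite oner_eq0.
have := e 0; have := e 1; have := e 2; rewrite !mnmE /=.
move=> /= -> -> ->; apply: expoP; rewrite /=; lia.
Qed.
End Laurent.

(** * Comparison of the two sides *)

Section SqrtRingMorphism.
Variables (K : fieldType) (Omega : closedFieldType) (iota : {rmorphism K -> Omega}).

Lemma sqrt_ring_in_zmod : zmod_morphism (sqrt_ring_in iota).
Proof. by move=> x y; apply: val_inj; rewrite /= rmorphB. Qed.
Lemma sqrt_ring_in_monoid : monoid_morphism (sqrt_ring_in iota).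
Proof.
by split=> [|x y]; apply: val_inj; rewrite /= ?rmorph1 ?rmorphM.
Qed.
HB.instance Definition _ :=
  GRing.isZmodMorphism.Build K (sqrt_ring iota) (sqrt_ring_in iota) sqrt_ring_in_zmod.
HB.instance Definition _ :=
  GRing.isMonoidMorphism.Build K (sqrt_ring iota) (sqrt_ring_in iota) sqrt_ring_in_monoid.
End SqrtRingMorphism.

Section Specialization.
Variables (R : realType) (Omega : closedFieldType) (iota : {rmorphism ratfun R -> Omega}).

(** The computations with powers of v can be done in the field of rational functions,
which embeds into the ring of square roots. *)
Lemma vpow_laurent a : vpow iota a = sqrt_ring_in iota (laurent R a).
Proof. by rewrite !rmorphM /= !rmorphXz ?unitfE ?ratfun_var_neq0. Qed.

Lemma vpowD : {morph vpow iota : a b / a + b >-> a * b}.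
Proof. by move=> a b; rewrite !vpow_laurent laurentD rmorphM. Qed.

Lemma vpow_eq1 a : vpow iota a = 1 -> a = 0.
Proof.
rewrite vpow_laurent -(rmorph1 (sqrt_ring_in iota)) => /fmorph_inj.
exact: laurent_eq1.
Qed.

Lemma vpow_neq0 a : vpow iota a != 0.
Proof.
rewrite vpow_laurent fmorph_eq0 /laurent !mulf_neq0 //;
  by rewrite expfz_neq0 ?ratfun_var_neq0.
Qed.

Lemma vpow_ez1 : vpow iota (ez 1) = qv iota.
Proof. by rewrite /vpow /= !expr0z !mulr1 expr1z. Qed.

Lemma vpow_sub_eq0 a : vpow iota a - vpow iota (- a) = 0 -> a = 0.
Proof.
move=> /eqP; rewrite subr_eq0 => /eqP e.
have : vpow iota (a + a) = 1.
  rewrite vpowD {1}e -vpowD addNr.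
  by rewrite (wt0 vpowD vpow_neq0).
by case: a {e} => [[x y] z] /vpow_eq1 [h1 h2 h3]; apply: expoP => /=; lia.
Qed.

Lemma qint_neq0 a : a != 0 -> qint iota a != 0.
Proof.
move=> a0; rewrite /qint -vpow_ez1 -(wtN vpowD vpow_neq0).
by rewrite mulf_neq0 ?invr_eq0 //; apply: contra_neqN (a0) => /eqP/vpow_sub_eq0.
Qed.
End Specialization.

(** Here r, r^-1 * s and c are the powers of v and the square root in the components,
and x, y their two denominators. *)
Lemma scalar_regroup (F : fieldType) (r s c x y : F) : r != 0 ->
  s / (x * y) * c ^+ 2 = r / x * c * (r^-1 * s / y * c).
Proof.
by move=> r0; rewrite invfM; move: x^-1 y^-1 => {}x {}y; field.
Qed.

Theorem theorem8p9 (R : realType) (Omega : closedFieldType)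
    (iota : {rmorphism ratfun R -> Omega})
    (Omega_alg : forall x : Omega, algebraicOver iota x)
    (sq : expo -> sqrt_ring iota) (sqP : sqrt_choice sq)
    (B : Verma_v iota -> Verma_vbar iota -> sqrt_ring iota) (BP : Verma_pairing B)
    (m : nat -> nat -> nat -> Verma_v iota)
    (mP : GT_basis (w_v iota) (vpow iota) sq m)
    (mbar : nat -> nat -> nat -> Verma_vbar iota)
    (mbarP : GT_basis (w_vbar iota) (fun a => (vpow iota a)^-1) sq mbar)
    (d1 d2 n : nat) (le_n_d : (n <= minn d1 d2)%N) :
  let q := qv iota ^+ 2 in
  let z1 := vpow iota ((lam1 - lam2 + ez 1) *+ 2) in
  let z2 := vpow iota ((lam2 - lam3 + ez 1) *+ 2) in
  I_coef q z1 z2 d1 d2 n = B (omega sq m d1 d2 n) (omega_bar sq mbar d1 d2 n).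
Proof.
move=> q z1 z2; have [sq0 sqE] := sqP.
have v0 : qv iota != 0 by rewrite -vpow_ez1 vpow_neq0.
have BE i x y : B (UE i *: x) y = B x (UF i *: y).
  by rewrite (pairing_adj BP) tauE // sigmaF.
have BF i x y : B (UF i *: x) y = B x (UE i *: y).
  by rewrite (pairing_adj BP) tauF // sigmaE.
have sq_neq0 a : bracket_arg a -> a != 0 -> sq a != 0.
  by move=> ha /(qint_neq0 iota); rewrite -sqE // expf_eq0.
have mm : B (m d1 d2 n) (mbar d1 d2 n) = 1.
  have dual := GT_dual mP mbarP (pairing_linl BP) (pairing_linr BP)
    (pairing_w BP) BE BF sq0 sq_neq0 le_n_d.
  by rewrite dual // eqxx.
rewrite /omega /omega_bar (pairingZl (pairing_linl BP)).
rewrite (pairingZr (pairing_linr BP)) mm mulr1.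
have delta0 : vpow iota (ez 1) - (vpow iota (ez 1))^-1 != 0.
  rewrite -(wtN (@vpowD _ _ iota) (@vpow_neq0 _ _ iota)).
  by apply/eqP => /vpow_sub_eq0.
have := I_coefE (@vpowD _ _ iota) (@vpow_neq0 _ _ iota) delta0 le_n_d.
rewrite vpow_ez1 => ->.
rewrite -/(qint iota) -(c_coef_sqr (br := qint iota) sqE).
have -> : vpow iota (- r_expo d1 d2 n + s_expo d1 d2)
    = (vpow iota (r_expo d1 d2 n))^-1 * vpow iota (s_expo d1 d2).
  by rewrite vpowD (wtN (@vpowD _ _ iota) (@vpow_neq0 _ _ iota)).
exact: scalar_regroup (vpow_neq0 iota (r_expo d1 d2 n)).
Qed.
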